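(* Consider the projection-constrained nonlinear opinion dynamics $$\dot{\boldsymbol{Z}}_i = P_i\,\mathbf{F}_i(\boldsymbol{Z}),\qquad F_{ij}(\boldsymbol{Z}) = -d z_{ij} + S\Big(u\big(\alpha z_{ij} + \gamma \sum_{k\neq i} (A_{\rm a})_{ik} z_{kj}\big)\Big) + b_{ij},$$ $i\in\{1,\dots,N_{\rm a}\}$, $j\in\{1,\dots,N_{\rm o}\}$, with rank-one projections $P_i=\hat{\mathbf p}_i\hat{\mathbf p}_i^T$, $\hat{\mathbf p}_i=\mathbf p_i/\|\mathbf p_i\|$, for every agent $i$, restricted to the constraint subspace $V_{P_1}\times V_{P_2}\times\dots\times V_{P_{N_{\rm a}}}$. The flow is exactly characterized by the dynamics of the effective opinion vector $\mathbf y=(y_1,\dots,y_{N_{\rm a}})^T\in\mathbb{R}^{N_{\rm a}}$ with effective bias $\mathbf b_e=(b_{e1},\dots,b_{eN_{\rm a}})^T\in\mathbb{R}^{N_{\rm a}}$, where $y_i=\hat{\mathbf p}_i^T\boldsymbol{Z}_i$ (so that $\boldsymbol{Z}_i=y_i\hat{\mathbf p}_i$ on the constraint subspace) and $b_{ei}=\hat{\mathbf p}_i^T\mathbf b_i$, which evolves as $\dot{\mathbf y}=\Phi(\mathbf y,u)$ with $$\dot y_i=\Phi_i(\mathbf y,u) = -d y_i+\hat{\mathbf p}_i^T S\Big(u\big(\alpha y_i\hat{\mathbf p}_i+\gamma\sum_{k\ne i}(A_{\rm a})_{ik}y_k\hat{\mathbf p}_k\big)\Big)+b_{ei},\qquad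 i=1,\dots,N_{\rm a},$$ where $S$ acts entrywise on vectors.
   Context: There are $N_{\rm a}$ agents and $N_{\rm o}$ options. $z_{ij}\in\mathbb{R}$ is the opinion of agent $i$ on option $j$; $\boldsymbol{Z}_i=(z_{i1},\dots,z_{iN_{\rm o}})^T$; $\boldsymbol{Z}=(\boldsymbol{Z}_1^T,\dots,\boldsymbol{Z}_{N_{\rm a}}^T)^T$; $\mathbf{F}_i=(F_{i1},\dots,F_{iN_{\rm o}})^T$; $\mathbf b_i=(b_{i1},\dots,b_{iN_{\rm o}})^T$. Each agent $i$ has a nonzero constraint vector $\mathbf p_i\in\mathbb{R}^{N_{\rm o}}$ ($\|\cdot\|$ is the Euclidean norm), and $V_{P_i}=\{\mathbf x\in\mathbb{R}^{N_{\rm o}}: (I-P_i)\mathbf x=0\}=\operatorname{span}\{\mathbf p_i\}$. $A_{\rm a}\in\mathbb{R}^{N_{\rm a}\times N_{\rm a}}$ is symmetric, irreducible, with entries in $\{0,1\}$ and zero diagonal. $S:\mathbb{R}\to\mathbb{R}$ is an odd sigmoidal saturating function with $S(0)=0$, $S'(0)=1$, $\operatorname{sign}(S''(z))=-\operatorname{sign}(z)$. Parameters: $u>0$, $d>0$, $\gamma>0$, $\alpha>0$, $b_{ij}\in\mathbb{R}$. *)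

(* Defs.v *)
From HB Require Import structures.
From mathcomp Require Import all_boot all_order all_algebra all_fingroup.
From mathcomp Require Import all_classical all_reals all_analysis.

Set Implicit Arguments.
Unset Strict Implicit.
Unset Printing Implicit Defensive.

Import Order.TTheory GRing.Theory Num.Theory.
Import numFieldNormedType.Exports.

Local Open Scope classical_set_scope.
Local Open Scope ring_scope.

(* The library norm `|x| on matrices is the sup norm, hence this definition. *)
Definition euclid_norm (R : realType) n (x : 'cV[R]_n) : R :=
  Num.sqrt (\sum_j x j 0 ^+ 2).

(* Reducible: some simultaneous permutation of rows and columns makes A block
   upper triangular with two nonempty diagonal blocks, of sizes k and n - k. *)
Definition reducible_mx (R : realType) n (A : 'M[R]_n) : Prop :=
  exists (s : 'S_n) (k : nat), (0 < k < n)%N /\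
    forall i j : 'I_n, (k <= i)%N -> (j < k)%N -> row_perm s (col_perm s A) i j = 0.

Definition irreducible_mx (R : realType) n (A : 'M[R]_n) : Prop :=
  ~ reducible_mx A.

(* By oddness, convergence at +oo is equivalent to saturation on both sides. *)
Record odd_sigmoid (R : realType) (S : R -> R) : Prop := OddSigmoid {
  sigmoid_odd : forall z, S (- z) = - S z;
  sigmoid_derivable : forall z, derivable S z 1;
  sigmoid_derivable2 : forall z, derivable S^`()%classic z 1;
  sigmoid_increasing : forall z, 0 < S^`()%classic z;
  sigmoid_saturating : cvg (S z @[z --> +oo]);
  sigmoid_at0 : S 0 = 0;
  sigmoid_slope0 : S^`()%classic 0 = 1;
  sigmoid_sign2 : forall z, Num.sg (S^`(2)%classic z) = - Num.sg z }.

(* Solutions of x' = f x on an interval J of any kind.  At an endpoint belonging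
   to J only continuity is required; when f is continuous the one-sided equation
   at that endpoint follows from the mean value theorem. *)
Definition solution_on (R : realType) (E : normedModType R)
    (J : interval R) (f : E -> E) (x : R -> E) : Prop :=
  {within [set` J], continuous x} /\
  forall t, ([set` J])° t -> is_derive t 1 x (f (x t)).

(* A state Z is stored as the Na x No matrix of the z_ij, so that the opinion
   vector of agent i is its i-th row, seen as a column vector. *)
Definition opinion (R : realType) Na No (Z : 'M[R]_(Na, No)) (i : 'I_Na) :
    'cV[R]_No :=
  (row i Z)^T.

Section Constraints.
Context (R : realType) (Na No : nat) (p : 'I_Na -> 'cV[R]_No).

Definition phat (i : 'I_Na) : 'cV[R]_No := (euclid_norm (p i))^-1 *: p i.

Definition proj (i : 'I_Na) : 'M[R]_No := phat i *m (phat i)^T.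

Definition constraint_space : set 'M[R]_(Na, No) :=
  [set Z | forall i, (1%:M - proj i) *m opinion Z i = 0].

Definition effective (Z : 'M[R]_(Na, No)) : 'cV[R]_Na :=
  \col_i ((phat i)^T *m opinion Z i) 0 0.

Definition lift_opinion (y : 'cV[R]_Na) : 'M[R]_(Na, No) :=
  \matrix_(i, j) (y i 0 *: phat i) j 0.

End Constraints.

Section Dynamics.
Context (R : realType) (Na No : nat) (p : 'I_Na -> 'cV[R]_No).
Context (A : 'M[R]_Na) (S : R -> R) (d gamma alpha : R) (b : 'M[R]_(Na, No)).

Definition drift (u : R) (Z : 'M[R]_(Na, No)) (i : 'I_Na) : 'cV[R]_No :=
  \col_j (- d * Z i j
          + S (u * (alpha * Z i j + gamma * \sum_(k | k != i) A i k * Z k j))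
          + b i j).

Definition projected_field (u : R) (Z : 'M[R]_(Na, No)) : 'M[R]_(Na, No) :=
  \matrix_(i, j) (proj p i *m drift u Z i) j 0.

Definition effective_bias : 'cV[R]_Na := effective p b.

Definition Phi (y : 'cV[R]_Na) (u : R) : 'cV[R]_Na :=
  \col_i (- d * y i 0
          + ((phat p i)^T *m
             map_mx S (u *: (alpha *: (y i 0 *: phat p i)
               + gamma *: \sum_(k | k != i) (A i k * y k 0) *: phat p k))) 0 0
          + effective_bias i 0).

End Dynamics.

(* Main.v *)
Require Import Defs.
From HB Require Import structures.
From mathcomp Require Import all_boot all_order all_algebra.
From mathcomp Require Import all_classical all_reals all_analysis.

Import Order.TTheory GRing.Theory Num.Theory.
Import numFieldNormedType.Exports.

Local Open Scope classical_set_scope.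
Local Open Scope ring_scope.

(** On row [i], the composite [lift_opinion p \o effective p] multiplies the
    opinion of agent [i] by the rank-one projection [P_i], so the constraint
    subspace is the set of fixed points of this linear map, while unit length
    of the [phat p i] gives [effective p \o lift_opinion p = id].  Hence the two
    maps are inverse linear isomorphisms between the constraint subspace and
    the space of effective opinions.  Since [P_i] is applied last in the
    projected field, every value of that field is the lift of the vector of
    the [phat_i^T F_i], and at a lifted state this vector is [Phi]
    ([projected_field_lift]).

    The statements about trajectories come from one principle: a linear map
    between matrix spaces is continuous, so it commutes with derivatives and
    carries solutions to solutions as soon as it intertwines the vector fields
    ([solution_on_linear_image]).  Applied to [effective p] and to
    [lift_opinion p] it gives the correspondence of trajectories.  Applied to
    [constraint_defect p], the linear map that vanishes exactly on the
    constraint subspace and kills every value of the projected field, it says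
    that the defect of a solution has zero derivative; by the mean value
    theorem the defect is constant on the interval, so the subspace is
    invariant. *)

(** * Images of solutions under linear maps *)

Section LinearImages.
Context {R : realType}.

Lemma sum_continuous {T : topologicalType} {W : normedModType R} {I : finType}
    (F : I -> T -> W) :
  (forall i, continuous (F i)) -> continuous (fun x => \sum_i F i x).
Proof.
move=> F_cont; rewrite -fct_sumE; elim/big_ind: _ => //.
- exact: cst_continuous.
- by move=> g h g_cont h_cont x; apply: cvgD; [exact: g_cont | exact: h_cont].
Qed.

(** A linear map is a combination of the finitely many coordinates with the
    constant coefficients [f (delta_mx i j)]. *)
Lemma linear_mx_continuous {m n : nat} {W : normedModType R}
    (f : {linear 'M[R]_(m, n) -> W}) : continuous f.
Proof.
have -> : (f : _ -> _) =
    fun M => \sum_i \sum_j M i j *: f (delta_mx i j).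
  apply/funext => M; rewrite {1}[M]matrix_sum_delta linear_sum.
  apply: eq_bigr => i _; rewrite linear_sum.
  by apply: eq_bigr => j _; rewrite linearZZ.
apply: sum_continuous => i; apply: sum_continuous => j M.
by apply: (@cvgZr_tmp _ _ _ (nbhs M)); exact: coord_continuous.
Qed.

(** The difference quotient of [f \o x] is the image under [f] of that of [x],
    and continuity of [f] passes to the limit. *)
Lemma is_derive_linear_comp {U V W : normedModType R} (f : {linear V -> W})
    (x : U -> V) (a v : U) (dx : V) :
  continuous f -> is_derive a v x dx -> is_derive a v (f \o x) (f dx).
Proof.
move=> f_cont [x_drv <-].
suff quot : (fun h => h^-1 *: (((f \o x) \o shift a) (h *: v) - (f \o x) a))
    @ 0^' --> f ('D_v x a).
  by split; [exact: cvgP quot | exact: cvg_lim quot].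
have -> : (fun h => h^-1 *: (((f \o x) \o shift a) (h *: v) - (f \o x) a)) =
    f \o (fun h => h^-1 *: ((x \o shift a) (h *: v) - x a)).
  by apply/funext => h /=; rewrite linearZZ [f (_ - _)]linearB.
by apply: continuous_cvg => //; exact: f_cont.
Qed.

(** The intertwining relation is required only along the trajectory, so that
    [L] may relate the two fields on a subspace containing it. *)
Lemma solution_on_linear_image {m n k l : nat}
    (L : {linear 'M[R]_(m, n) -> 'M[R]_(k, l)}) (J : interval R)
    (f : 'M[R]_(m, n) -> 'M[R]_(m, n)) (g : 'M[R]_(k, l) -> 'M[R]_(k, l))
    (x : R -> 'M[R]_(m, n)) :
  (forall t, t \in J -> L (f (x t)) = g (L (x t))) ->
  solution_on J f x -> solution_on J g (L \o x).
Proof.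
move=> Lfg [x_cont x_drv]; split.
  by apply: within_continuous_comp => // M _; exact: linear_mx_continuous.
move=> t Jt; rewrite /= -Lfg; last exact: (interior_subset Jt).
by apply: is_derive_linear_comp; [exact: linear_mx_continuous | exact: x_drv].
Qed.

(** Equality on [J] is enough because the equation is imposed at interior
    points of [J] only, around which the two functions agree. *)
Lemma eq_solution_on {E : normedModType R} (J : interval R) (f : E -> E)
    (x y : R -> E) :
  (forall t, t \in J -> x t = y t) -> solution_on J f x -> solution_on J f y.
Proof.
move=> xy [x_cont x_drv]; split.
  by apply: subspace_eq_continuous x_cont => t; rewrite inE => /xy.
move=> t Jt; rewrite -xy; last exact: (interior_subset Jt).
by apply: near_eq_is_derive (x_drv t Jt); apply: filterS Jt => s /xy.
Qed.

(** The mean value theorem holds for real functions, hence it is applied to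
    each entry separately. *)
Lemma stationary_solution_constant {m n : nat} (J : interval R)
    (w : R -> 'M[R]_(m, n)) (s t : R) :
  solution_on J (fun=> 0) w -> s \in J -> t \in J -> w s = w t.
Proof.
wlog st : s t / s <= t => [hwlog|].
  have [/hwlog //|/ltW ts] := leP s t.
  by move=> w_sol Js Jt; apply/esym; exact: hwlog.
move=> [w_cont w_drv] Js Jt; apply/matrixP => i j.
have stJ : `[s, t] `<=` [set` J].
  by move=> r /=; rewrite in_itv /=; exact: interval_is_interval.
have [r _] : exists2 r, r \in `[s, t] & w t i j - w s i j = 0 * (t - s).
  apply: (@MVT_segment R (fun r => w r i j) (cst 0)) => //.
    move=> r r_st; have [|w_der Dw] := w_drv r.
      by apply: (interiorS stJ); rewrite interior_itv_bnd.
    split; first exact: (derivable_mxP _ _ _).1 w_der i j.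
    by have := derive_mx w_der; rewrite Dw => /matrixP/(_ i j); rewrite !mxE.
  apply: (@within_continuous_comp _ _ _ _ w (fun M => M i j)).
    by move=> M _; exact: coord_continuous.
  exact: continuous_subspaceW w_cont.
by rewrite mul0r => /eqP; rewrite subr_eq0 => /eqP.
Qed.

End LinearImages.

(** * Geometry of the constraint subspace *)

Section ConstraintSpace.
Context {R : realType} {Na No : nat} (p : 'I_Na -> 'cV[R]_No).

Lemma sqr_euclid_norm (n : nat) (x : 'cV[R]_n) :
  euclid_norm x ^+ 2 = \sum_j x j 0 ^+ 2.
Proof. by rewrite sqr_sqrtr // sumr_ge0 // => j _; exact: sqr_ge0. Qed.

Lemma euclid_norm_eq0 (n : nat) (x : 'cV[R]_n) : (euclid_norm x == 0) = (x == 0).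
Proof.
apply/idP/eqP => [|->]; last first.
  by rewrite -sqrf_eq0 sqr_euclid_norm big1 // => j _; rewrite mxE expr0n.
rewrite -sqrf_eq0 sqr_euclid_norm => /eqP sum0; apply/colP => j; rewrite mxE.
have /(_ predT sum0 j isT) /eqP := psumr_eq0P (fun j _ => sqr_ge0 (x j 0)).
by rewrite sqrf_eq0 => /eqP.
Qed.

Lemma phat_unit (i : 'I_Na) : p i != 0 -> (phat p i)^T *m phat p i = 1%:M.
Proof.
rewrite -euclid_norm_eq0 => pi_neq0; apply/matrixP => a c.
rewrite !ord1 !mxE eqxx.
under eq_bigr do rewrite !mxE -expr2 exprMn.
by rewrite -mulr_sumr -sqr_euclid_norm exprVn mulVf // sqrf_eq0.
Qed.

Lemma opinion_inj (Z Z' : 'M[R]_(Na, No)) : opinion Z =1 opinion Z' -> Z = Z'.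
Proof.
move=> ZZ'; apply/matrixP => i j.
by have /colP/(_ j) := ZZ' i; rewrite !mxE.
Qed.

Lemma opinion_lift (y : 'cV[R]_Na) (i : 'I_Na) :
  opinion (lift_opinion p y) i = y i 0 *: phat p i.
Proof. by apply/colP => j; rewrite !mxE. Qed.

Lemma proj_mulE (x : 'cV[R]_No) (i : 'I_Na) :
  Defs.proj p i *m x = ((phat p i)^T *m x) 0 0 *: phat p i.
Proof. by rewrite /Defs.proj -mulmxA -mul_mx_scalar -mx11_scalar. Qed.

Lemma opinion_lift_effective (Z : 'M[R]_(Na, No)) (i : 'I_Na) :
  opinion (lift_opinion p (effective p Z)) i = Defs.proj p i *m opinion Z i.
Proof. by rewrite opinion_lift proj_mulE mxE. Qed.

(** The row-wise equations [(1 - P_i) Z_i = 0] become one fixed-point equation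
    for a linear map. *)
Lemma constraint_spaceP (Z : 'M[R]_(Na, No)) :
  constraint_space p Z <-> lift_opinion p (effective p Z) = Z.
Proof.
split=> [Z_in | Z_fix i].
  apply: opinion_inj => i; rewrite opinion_lift_effective.
  by have /eqP := Z_in i; rewrite mulmxBl mul1mx subr_eq0 => /eqP.
by rewrite mulmxBl mul1mx -opinion_lift_effective Z_fix subrr.
Qed.

Lemma effective_is_linear : linear (effective p).
Proof.
move=> c Z Z'; apply/colP => i.
by rewrite [LHS]mxE /opinion 2!linearP mulmxDr -scalemxAr !mxE.
Qed.

HB.instance Definition _ := GRing.isLinear.Build R 'M[R]_(Na, No) 'cV[R]_Na
  *:%R (effective p) effective_is_linear.

Lemma lift_opinion_is_linear : linear (lift_opinion p).
Proof.
by move=> c y y'; apply/matrixP => i j; rewrite !mxE mulrDl mulrA.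
Qed.

HB.instance Definition _ := GRing.isLinear.Build R 'cV[R]_Na 'M[R]_(Na, No)
  *:%R (lift_opinion p) lift_opinion_is_linear.

(** The component of [Z] orthogonal to the constraint subspace, a linear
    function of the whole state that measures the violation of all the
    constraints at once. *)
Definition constraint_defect (Z : 'M[R]_(Na, No)) : 'M[R]_(Na, No) :=
  Z - lift_opinion p (effective p Z).

Lemma constraint_defect_is_linear : linear constraint_defect.
Proof.
by move=> c Z Z'; rewrite /constraint_defect 2!linearP scalerBr opprD addrACA.
Qed.

HB.instance Definition _ := GRing.isLinear.Build R 'M[R]_(Na, No)
  'M[R]_(Na, No) *:%R constraint_defect constraint_defect_is_linear.

Lemma constraint_defect_eq0 (Z : 'M[R]_(Na, No)) :
  constraint_defect Z = 0 <-> constraint_space p Z.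
Proof.
rewrite constraint_spaceP; split=> [/eqP | ZE].
  by rewrite subr_eq0 => /eqP.
by rewrite /constraint_defect ZE subrr.
Qed.

Context (p_neq0 : forall i, p i != 0).

Lemma lift_opinionK : cancel (lift_opinion p) (effective p).
Proof.
move=> y; apply/colP => i.
by rewrite mxE opinion_lift -scalemxAr phat_unit // !mxE eqxx mulr1.
Qed.

Lemma lift_opinion_in (y : 'cV[R]_Na) : constraint_space p (lift_opinion p y).
Proof. by apply/constraint_spaceP; rewrite lift_opinionK. Qed.

End ConstraintSpace.

(** * The projected and the effective dynamics *)

Section Fields.
Context {R : realType} {Na No : nat} (p : 'I_Na -> 'cV[R]_No).
Context (A : 'M[R]_Na) (S : R -> R) (u d gamma alpha : R) (b : 'M[R]_(Na, No)).
Context (p_neq0 : forall i, p i != 0).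

Let F := projected_field p A S d gamma alpha b u.
Let G y := Phi p A S d gamma alpha b y u.

Lemma projected_fieldE (Z : 'M[R]_(Na, No)) :
  F Z = lift_opinion p
    (\col_i ((phat p i)^T *m drift A S d gamma alpha b u Z i) 0 0).
Proof. by apply/matrixP => i j; rewrite mxE proj_mulE !mxE. Qed.

(** The field takes its values in the subspace at every state, also outside
    the subspace: this is what makes the defect of any solution constant. *)
Lemma projected_field_in (Z : 'M[R]_(Na, No)) : constraint_space p (F Z).
Proof. by rewrite projected_fieldE; exact: lift_opinion_in. Qed.

Lemma drift_lift (y : 'cV[R]_Na) (i : 'I_Na) :
  drift A S d gamma alpha b u (lift_opinion p y) i =
  - d *: (y i 0 *: phat p i)
  + map_mx S (u *: (alpha *: (y i 0 *: phat p i)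
      + gamma *: \sum_(k | k != i) (A i k * y k 0) *: phat p k))
  + opinion b i.
Proof.
apply/colP => j; rewrite !mxE summxE; congr (_ + S (_ * (_ + _ * _)) + _).
by apply: eq_bigr => k _; rewrite !mxE mulrA.
Qed.

Lemma projected_field_lift (y : 'cV[R]_Na) :
  F (lift_opinion p y) = lift_opinion p (G y).
Proof.
rewrite projected_fieldE; congr lift_opinion; apply/colP => i.
rewrite [in LHS]mxE drift_lift !mulmxDr -2!scalemxAr phat_unit //.
by rewrite [G y _ _]mxE !mxE eqxx mulr1.
Qed.

Lemma constraint_space_invariant (J : interval R) (Z : R -> 'M[R]_(Na, No))
    (s t : R) :
  solution_on J F Z -> s \in J -> t \in J ->
  constraint_space p (Z s) -> constraint_space p (Z t).
Proof.
move=> Z_sol Js Jt Zs_in; apply/constraint_defect_eq0.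
have W_sol : solution_on J (fun=> 0) (constraint_defect p \o Z).
  apply: solution_on_linear_image Z_sol => r _.
  exact/constraint_defect_eq0/projected_field_in.
rewrite -[LHS](stationary_solution_constant J _ s t W_sol Js Jt).
exact/constraint_defect_eq0.
Qed.

Lemma solution_on_effective (J : interval R) (Z : R -> 'M[R]_(Na, No)) :
  (forall t, t \in J -> constraint_space p (Z t)) ->
  solution_on J F Z <-> solution_on J G (fun t => effective p (Z t)).
Proof.
move=> Z_in; have liftZ t : t \in J -> lift_opinion p (effective p (Z t)) = Z t.
  by move=> /Z_in /constraint_spaceP.
split=> [|y_sol].
  (* [effective p] intertwines the fields on the constraint subspace only. *)
  apply: (solution_on_linear_image (effective p)) => t Jt.
  by rewrite -[in LHS]liftZ // projected_field_lift /= lift_opinionK.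
apply: (eq_solution_on J _ _ _ liftZ).
apply: (solution_on_linear_image (lift_opinion p)) y_sol => t _.
by rewrite projected_field_lift.
Qed.

End Fields.

Theorem mainTheorem2 (R : realType) (Na No : nat)
    (p : 'I_Na -> 'cV[R]_No) (A : 'M[R]_Na) (S : R -> R)
    (u d gamma alpha : R) (b : 'M[R]_(Na, No))
    (p_neq0 : forall i, p i != 0)
    (A_sym : A^T = A)
    (A_irr : irreducible_mx A)
    (A_01 : forall i k, A i k = 0 \/ A i k = 1)
    (A_diag : forall i, A i i = 0)
    (S_sigmoid : odd_sigmoid S)
    (u_gt0 : 0 < u) (d_gt0 : 0 < d) (gamma_gt0 : 0 < gamma)
    (alpha_gt0 : 0 < alpha) :
  (* y |-> (y_i phat_i)_i and Z |-> (phat_i^T Z_i)_i are inverse bijections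
     between R^Na and the constraint subspace *)
  (forall Z, constraint_space p Z ->
     forall i, opinion Z i = effective p Z i 0 *: phat p i) /\
  (forall y, constraint_space p (lift_opinion p y) /\
     effective p (lift_opinion p y) = y) /\
  (* on the constraint subspace, these bijections conjugate the vector fields *)
  (forall y, projected_field p A S d gamma alpha b u (lift_opinion p y)
     = lift_opinion p (Phi p A S d gamma alpha b y u)) /\
  (* the constraint subspace is invariant *)
  (forall (J : interval R) (Z : R -> 'M[R]_(Na, No)) (t0 : R),
     solution_on J (projected_field p A S d gamma alpha b u) Z ->
     t0 \in J -> constraint_space p (Z t0) ->
     forall t, t \in J -> constraint_space p (Z t)) /\
  (* on it, the trajectories are exactly those of the effective dynamics *)
  (forall (J : interval R) (Z : R -> 'M[R]_(Na, No)),
     (forall t, t \in J -> constraint_space p (Z t)) ->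
     (solution_on J (projected_field p A S d gamma alpha b u) Z <->
      solution_on J (fun y => Phi p A S d gamma alpha b y u)
        (fun t => effective p (Z t)))).
Proof.
split; [|split; [|split; [|split]]].
- move=> Z /constraint_spaceP ZE i.
  by rewrite -[in LHS]ZE opinion_lift.
- by move=> y; split; [exact: lift_opinion_in | exact: lift_opinionK].
- exact: projected_field_lift.
- move=> J Z t0 Z_sol Jt0 Z_in t Jt.
  exact: constraint_space_invariant Z_sol Jt0 Jt Z_in.
- by move=> J Z Z_in; exact: solution_on_effective.
Qed.
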